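(* For any real number $\beta>-1$, the triple $\mathcal{E}_\beta=(T,\mathbb{P}_2(T),\Sigma^{\mathrm{enr}}_{T,\beta})$, where $\Sigma^{\mathrm{enr}}_{T,\beta}=\{\mathcal{I}^{\mathrm{CR}}_j,\mathcal{G}^{\mathrm{enr}}_{j,\beta} : j=1,2,3\}$, is a finite element.
   Context: Let $T\subset\mathbb{R}^2$ be a nondegenerate triangle with vertices $\boldsymbol{v}_1,\boldsymbol{v}_2,\boldsymbol{v}_3$, with the convention $\boldsymbol{v}_4=\boldsymbol{v}_1$, $\boldsymbol{v}_5=\boldsymbol{v}_2$, and let $\boldsymbol{m}^\star=\frac{\boldsymbol{v}_1+\boldsymbol{v}_2+\boldsymbol{v}_3}{3}$ be its center of gravity. Let $\mathbb{P}_2(T)$ be the space of real bivariate polynomials of total degree at most $2$, regarded as functions on $T$. For $j=1,2,3$ and $\beta>-1$ define the linear functionals $$\mathcal{I}^{\mathrm{CR}}_j(f)=\int_0^1 f\left(t\boldsymbol{v}_{j+1}+(1-t)\boldsymbol{v}_{j+2}\right)dt,\qquad \mathcal{G}^{\mathrm{enr}}_{j,\beta}(f)=\int_0^1 w_\beta(t)\, f\left(t\boldsymbol{v}_j+(1-t)\boldsymbol{m}^\star\right)dt,\qquad w_\beta(t)=t^\beta(1-t)^\beta.$$ A finite element is a triple $(S,\mathbb{F},\Sigma)$ where $S$ is a polytope in $\mathbb{R}^d$, $\mathbb{F}$ is an $n$-dimensional vector space of real-valued functions on $S$, and $\Sigma=\{L_j : j=1,\dots,n\}$ is a set of $n$ linearly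 independent linear functionals on $\mathbb{F}$ such that $\mathbb{F}$ is $\Sigma$-unisolvent, i.e. if $f\in\mathbb{F}$ and $L_j(f)=0$ for all $j=1,\dots,n$, then $f=0$. *)

(* Defs.v *)
From HB Require Import structures.
From mathcomp Require Import all_boot all_order all_algebra.
From mathcomp Require Import all_classical all_reals all_analysis.
(* The notations of mpoly clash with those of the analysis library. *)
From mathcomp Require mpoly.
Import (canonicals, coercions) mpoly.

Set Implicit Arguments.
Unset Strict Implicit.
Unset Printing Implicit Defensive.

Import Order.TTheory GRing.Theory Num.Theory.
Import numFieldNormedType.Exports.

Local Open Scope classical_set_scope.
Local Open Scope ring_scope.

(* Functions on a set S of points have type S -> R, with S coerced to the
   subtype of its elements, so that two of them are equal iff they agree on S. *)

Section Geometry.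
Context {R : realType} {d : nat}.

Definition convex_hull n (v : 'I_n -> 'rV[R]_d) : set 'rV[R]_d :=
  [set x | exists c : 'I_n -> R,
     [/\ forall i, 0 <= c i, \sum_i c i = 1 & x = \sum_i c i *: v i]].

Definition is_polytope (S : set 'rV[R]_d) : Prop :=
  exists n (v : 'I_n.+1 -> 'rV[R]_d), S = convex_hull v.

Definition affinely_independent n (v : 'I_n -> 'rV[R]_d) : Prop :=
  forall c : 'I_n -> R,
    \sum_i c i = 0 -> \sum_i c i *: v i = 0 -> forall i, c i = 0.

(* Restrictions to S of the real polynomials in d variables of total degree at
   most k; mpoly.msize is the total degree plus one for nonzero polynomials. *)
Definition polynomials_on (k : nat) (S : set 'rV[R]_d) : set (S -> R) :=
  [set f | exists2 p : mpoly.mpoly d R,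
     (mpoly.msize p <= k.+1)%N
     & forall x : S, f x = mpoly.meval (fun i => set_val x 0 i) p].

End Geometry.

Arguments polynomials_on {R d} k S _.

Section FiniteElement.
Context {R : realType}.

Definition is_basis {X : Type} n (F : set (X -> R)) (b : 'I_n -> X -> R) : Prop :=
  (forall f, F f <-> exists c : 'I_n -> R, forall x, f x = \sum_i c i * b i x) /\
  (forall c : 'I_n -> R,
     (forall x, \sum_i c i * b i x = 0) -> forall i, c i = 0).

(* F is a linear subspace of X -> R of dimension n. *)
Definition has_dimension {X : Type} (F : set (X -> R)) (n : nat) : Prop :=
  exists b : 'I_n -> X -> R, is_basis F b.

(* A functional on F is represented by a map on all of X -> R, of which only
   the values on F matter. *)
Definition linear_functional_on {X : Type} (F : set (X -> R))
    (L : (X -> R) -> R) : Prop :=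
  forall (a : R) f g, F f -> F g ->
    L (fun x => a * f x + g x) = a * L f + L g.

Definition linearly_independent_on {X : Type} n (F : set (X -> R))
    (L : 'I_n -> (X -> R) -> R) : Prop :=
  forall c : 'I_n -> R,
    (forall f, F f -> \sum_j c j * L j f = 0) -> forall j, c j = 0.

Definition unisolvent {X : Type} (F : set (X -> R))
    (Sigma : set ((X -> R) -> R)) : Prop :=
  forall f, F f -> (forall L, Sigma L -> L f = 0) -> forall x, f x = 0.

Definition is_finite_element (d : nat) (S : set 'rV[R]_d) (F : set (S -> R))
    (Sigma : set ((S -> R) -> R)) : Prop :=
  is_polytope S /\
  exists n : nat,
    has_dimension F n /\
    (exists L : 'I_n -> (S -> R) -> R,
       [/\ Sigma = range L,
           forall j, linear_functional_on F (L j)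
         & linearly_independent_on F L]) /\
    unisolvent F Sigma.

End FiniteElement.

Arguments is_finite_element {R d} S F Sigma.

Section EnrichedElement.
Context {R : realType}.
(* The vertices are indexed by 0, 1, 2 and ordS is the cyclic successor. *)
Variable v : 'I_3 -> 'rV[R]_2.

Local Notation T := (convex_hull v).

Definition barycenter : 'rV[R]_2 := 3%:R^-1 *: \sum_i v i.

(* \int_0^1 w(t) f(t a + (1 - t) b) dt for the segment [b, a] contained in S;
   'valL_ 0 f extends f by 0 outside S. *)
Definition segment_integral (S : set 'rV[R]_2) (w : R -> R) (a b : 'rV[R]_2)
    (f : S -> R) : R :=
  (\int[lebesgue_measure]_(t in `[0, 1])
     (w t * valL_ 0 f (t *: a + (1 - t) *: b)))%R.

(* For beta < 0 the weight is singular at 0 and 1, where powR takes the value 0;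
   this does not affect the integral. *)
Definition weight (beta : R) (t : R) : R := t `^ beta * (1 - t) `^ beta.

Definition I_CR (j : 'I_3) : (T -> R) -> R :=
  segment_integral (fun=> 1) (v (ordS j)) (v (ordS (ordS j))).

Definition G_enr (beta : R) (j : 'I_3) : (T -> R) -> R :=
  segment_integral (weight beta) (v j) barycenter.

Definition Sigma_enr (beta : R) : set ((T -> R) -> R) :=
  range I_CR `|` range (G_enr beta).

End EnrichedElement.

Arguments I_CR {R} v j _.
Arguments G_enr {R} v beta j _.
Arguments Sigma_enr {R} v beta _.

(* Main.v *)
(* In the barycentric coordinates l_0, l_1, l_2 the quadratic polynomials are the
   forms Q = sum_j (p_j l_j^2 + q_j l_(j+1) l_(j+2)), so the dimension is 6.
   Restricted to a segment t a + (1 - t) b, such a form is a combination of t^2,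
   t (1 - t) and (1 - t)^2; as the weight is invariant under t |-> 1 - t, its
   weighted integral only involves the moments D of t^2 and E of t (1 - t).
   If the edge functionals vanish then q_j = - 2 (p_(j+1) + p_(j+2)), and with
   P = p_0 + p_1 + p_2 the vanishing of the functionals on the medians reads
   (p_j - P / 3) D = (2 / 3) P E. Summing over j gives P E = 0, hence P = 0,
   hence every p_j, and every q_j, is 0. *)
Require Import Defs.
From mathcomp Require Import all_boot all_order all_algebra.
From mathcomp Require Import all_classical all_reals all_analysis.
From mathcomp Require Import measurable_realfun.
From mathcomp Require Import ring lra.
From mathcomp Require mpoly.
Import (canonicals, coercions) mpoly.

Import Order.TTheory GRing.Theory Num.Theory.
Import numFieldNormedType.Exports.

Local Open Scope classical_set_scope.
Local Open Scope ring_scope.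

(** * Integrability, symmetry and moments of the weight *)

Section Weight.
Context {R : realType}.
Local Notation mu := (@lebesgue_measure R).
Implicit Types (b x t : R) (f g : R -> R).

Lemma measurable_EFin_comp f (A : set R) :
  measurable_fun [set: R] f -> measurable_fun A (EFin \o f).
Proof. by move=> mf; apply/measurable_EFinP; exact: measurable_funTS. Qed.

(** Fundamental theorem of calculus with the antiderivative [G]. The bound does not depend on [x],
    so it survives the limit where [x] tends to 0. *)
Lemma integral_powR_le b x : -1 < b -> 0 < x <= 1 ->
  (\int[mu]_(t in `[x, 1%R]) (t `^ b)%:E <= ((b + 1)^-1)%:E)%E.
Proof.
move=> hb /andP[x0]; have b1 : 0 < b + 1 by lra.
pose G : R -> R := (b + 1)^-1 *: (@powR R ^~ (b + 1)).
rewrite le_eqVlt => /predU1P[->|x1].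
  by rewrite set_itv1 integral_set1 lee_fin invr_ge0 ltW.
have GE t : G t = (b + 1)^-1 * t `^ (b + 1) by [].
have dF t : 0 < t ->
    is_derive t (1:R) G (t `^ b).
  move=> t0; have Dt : derivable (@powR R ^~ (b + 1)) t 1.
    by apply: derivable_powR; rewrite in_itv/= t0.
  apply: DeriveDef; first exact: derivableZ.
  rewrite deriveZ// -derive1E powR_derive1 ?in_itv/= ?t0//.
  by rewrite addrK scalerA mulVf ?gt_eqF// scale1r.
have cF t : 0 < t -> {for t, continuous G}.
  move=> t0; apply: differentiable_continuous; apply/derivable1_diffP.
  by have [] := dF _ t0.
rewrite (@continuous_FTC2 _ _ G)//.
- rewrite !GE powR1 mulr1 -EFinB lee_fin lerBlDr lerDl.
  by rewrite mulr_ge0 ?powR_ge0 ?invr_ge0 ?ltW.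
- apply: continuous_in_subspaceT => t; rewrite inE/= in_itv/= => /andP[xt _].
  apply: differentiable_continuous; apply/derivable1_diffP.
  by apply: derivable_powR; rewrite in_itv/= (lt_le_trans x0).
- split.
  + move=> t; rewrite in_itv/= => /andP[xt _].
    by have [] := dF _ (lt_trans x0 xt).
  + by apply: cvg_at_right_filter; exact: cF.
  + by apply: cvg_at_left_filter; apply: cF.
- move=> t; rewrite in_itv/= => /andP[xt _]; rewrite derive1E.
  by have [_ ->] := dF _ (lt_trans x0 xt).
Qed.

Lemma integrable_powR01 b : -1 < b ->
  mu.-integrable `[0, 1] (EFin \o (@powR R ^~ b)).
Proof.
move=> hb; have mp (A : set R) : measurable_fun A (EFin \o (@powR R ^~ b)).
  by apply: measurable_EFin_comp; exact: measurable_powR.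
apply/integrableP; split; first exact: mp.
under eq_integral => t _ do rewrite /= ger0_norm ?powR_ge0//.
rewrite -integral_itv_obnd_cbnd; last exact: mp.
(* The intervals [F n] avoid the possible singularity at 0 and exhaust the half-open interval, so
   monotone convergence carries the uniform bound over to the whole integral. *)
pose F (n : nat) := `[n.+1%:R^-1 : R, 1]%classic.
have -> : `]0, 1]%classic = \bigcup_n F n.
  apply/seteqP; split => [t|t [n _]] /=; rewrite /F /= !in_itv/=.
    move=> /andP[t0 t1]; have [k] := ltr_add_invr t0; rewrite add0r => kt.
    by exists k => //; rewrite /F /= in_itv/= (ltW kt).
  by move=> /andP[nt ->]; rewrite (lt_le_trans _ nt)// invr_gt0.
have cv : (\int[mu]_(x in F i) (EFin \o (@powR R ^~ b)) x)%E @[i --> \oo] -->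
    (\int[mu]_(x in \bigcup_i F i) (EFin \o (@powR R ^~ b)) x)%E.
  apply: ge0_nondecreasing_set_cvg_integral => //.
  - move=> n m nm; rewrite subsetEset => t; rewrite /F /= !in_itv/=.
    move=> /andP[nt ->]; rewrite andbT (le_trans _ nt)//.
    by rewrite lef_pV2 ?posrE// ler_nat.
  - by move=> n; exact: measurable_itv.
  - by move=> n; exact: mp.
  - by move=> n t _ /=; rewrite lee_fin powR_ge0.
apply: (@le_lt_trans _ _ (b + 1)^-1%:E); last exact: ltry.
rewrite -(cvg_lim _ cv)//; apply: lime_le; first by apply/cvg_ex; eexists; exact: cv.
apply: nearW => n; apply: integral_powR_le => //.
by rewrite invr_gt0 ltr0n/= invf_le1// ler1n.
Qed.

Lemma onem_preimage01 : (fun t : R => 1 - t) @^-1` `[0, 1] = `[0, 1]%classic.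
Proof.
by apply/seteqP; split=> t /=; rewrite !in_itv/= => /andP[h1 h2];
  apply/andP; split; lra.
Qed.

Lemma measurable_onem : measurable_fun [set: measurableTypeR R]
  (fun t : R => (1 - t : measurableTypeR R)).
Proof. exact: (@measurable_funB _ _ R setT (cst 1) id). Qed.

(** By uniqueness of Lebesgue measure it suffices to compare on half-open intervals, and reflection
    keeps their length, although it moves the open end to the other side. *)
Lemma lebesgue_measure_onem (A : set R) : measurable A ->
  pushforward mu (fun t : R => (1 - t : measurableTypeR R)) A = mu A.
Proof.
move=> mA; apply/esym/lebesgue_measure_unique => //=; first exact: measurable_onem.
move=> _ _ [[a b]] _ <-; rewrite /pushforward/=.
have -> : (fun t : R => (1 - t : measurableTypeR R)) @^-1` `]a, b] =
    `[1 - b, 1 - a[%classic.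
  by apply/seteqP; split=> t /=; rewrite !in_itv/= => /andP[h1 h2];
    apply/andP; split; lra.
rewrite !lebesgue_measure_itv/= !lte_fin.
have -> : (1 - b < 1 - a) = (a < b) by apply/idP/idP; lra.
by case: ifP => // _; rewrite -!EFinB; congr EFin; ring.
Qed.

Lemma ge0_integral_onem f : measurable_fun [set: R] f -> (forall t, 0 <= f t) ->
  (\int[mu]_(t in `[0%R, 1%R]) (f t)%:E =
   \int[mu]_(t in `[0%R, 1%R]) (f (1 - t)%R)%:E)%E.
Proof.
move=> mf f0; rewrite -[in RHS]onem_preimage01.
rewrite -[RHS](@ge0_integral_pushforward _ _ _ _ R _ measurable_onem mu `[0, 1] (EFin \o f))//=.
- apply: eq_measure_integral => //=; first exact: measurable_onem.
  by move=> _ A mA _; apply/esym/lebesgue_measure_onem.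
- exact: measurable_EFin_comp.
- by move=> t _; rewrite lee_fin.
Qed.

Lemma weight_ge0 b t : 0 <= weight b t.
Proof. by rewrite mulr_ge0 ?powR_ge0. Qed.

Lemma weight_gt0 b t : 0 < t < 1 -> 0 < weight b t.
Proof. by move=> /andP[t0 t1]; rewrite mulr_gt0 ?powR_gt0 ?subr_gt0. Qed.

Lemma weight_onem b t : weight b (1 - t) = weight b t.
Proof. by rewrite /weight subKr mulrC. Qed.

Lemma weight0 t : weight 0 t = 1.
Proof. by rewrite /weight !powRr0 mulr1. Qed.

Lemma measurable_powR_onem b : measurable_fun [set: R] (fun t => (1 - t) `^ b).
Proof.
apply: (@measurableT_comp _ _ _ _ _ _ (@powR R ^~ b) _ (fun t => 1 - t)).
  exact: measurable_powR.
exact: (@measurable_funB _ _ R setT (cst 1) id).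
Qed.

Lemma measurable_weight b : measurable_fun [set: R] (weight b).
Proof.
by apply: measurable_funM; [exact: measurable_powR|exact: measurable_powR_onem].
Qed.

(** For [b] nonnegative the power increases and is at most 1; for negative [b] it decreases and is
    largest at 1/2. The sum of the two bounds covers both signs. *)
Lemma powR_half_le b t : 1 / 2 <= t <= 1 -> t `^ b <= 1 + (1 / 2) `^ b.
Proof.
move=> /andP[t0 t1]; have tgt0 : 0 < t by lra.
have h0 : 0 <= (1 / 2 : R) `^ b by exact: powR_ge0.
have [b0|b0] := leP 0 b.
  have : t `^ b <= 1 `^ b by apply: ge0_ler_powR; rewrite ?nnegrE; lra.
  rewrite powR1; lra.
have half0 : 0 < (1 / 2 : R) by lra.
suff : t `^ b <= (1 / 2) `^ b by lra.
rewrite -(opprK b) !(powRN _ (- b)) lef_pV2 ?posrE ?powR_gt0//.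
apply: ge0_ler_powR; rewrite ?nnegrE; lra.
Qed.

(* The factor whose base is at least 1/2 is bounded, also when b < 0. *)
Lemma weight_le b t : 0 <= t <= 1 ->
  weight b t <= (1 + (1 / 2) `^ b) * (t `^ b + (1 - t) `^ b).
Proof.
move=> /andP[t0 t1]; have p0 := powR_ge0 t b; have q0 := powR_ge0 (1 - t) b.
have h0 : 0 <= (1 / 2 : R) `^ b by exact: powR_ge0.
rewrite /weight; have [th|th] := leP (1 / 2) t.
  have : t `^ b <= 1 + (1 / 2) `^ b by apply: powR_half_le; lra.
  nra.
have : (1 - t) `^ b <= 1 + (1 / 2) `^ b by apply: powR_half_le; lra.
nra.
Qed.

Lemma integrable_powR_onem01 b : -1 < b ->
  mu.-integrable `[0, 1] (EFin \o (fun t => (1 - t) `^ b)).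
Proof.
move=> /integrable_powR01 /integrableP[_ fin]; apply/integrableP; split.
  by apply: measurable_EFin_comp; exact: measurable_powR_onem.
move: fin; under eq_integral do rewrite /= ger0_norm ?powR_ge0//.
under [in X in _ -> X]eq_integral do rewrite /= ger0_norm ?powR_ge0//.
rewrite (@ge0_integral_onem (@powR R ^~ b))//.
by move=> t; exact: powR_ge0.
Qed.

Lemma integrable_weight b : -1 < b -> mu.-integrable `[0, 1] (EFin \o weight b).
Proof.
move=> hb; pose M : R := 1 + (1 / 2) `^ b.
have M0 : 0 <= M by rewrite addr_ge0 ?powR_ge0.
apply: (@le_integrable _ _ _ mu _ _ _
    (fun t => M%:E * ((t `^ b)%:E + ((1 - t) `^ b)%:E))%E) => //.
- by apply: measurable_EFin_comp; exact: measurable_weight.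
- move=> t; rewrite /= in_itv/= => t01.
  rewrite lee_fin !ger0_norm ?weight_ge0 ?weight_le//.
  by rewrite mulr_ge0 ?addr_ge0 ?powR_ge0.
- apply: integrableZl => //; apply: integrableD => //.
    exact: integrable_powR01.
  exact: integrable_powR_onem01.
Qed.

Lemma integrable_weightM b g : -1 < b -> measurable_fun [set: R] g ->
  (forall t, 0 <= t <= 1 -> 0 <= g t <= 1) ->
  mu.-integrable `[0, 1] (EFin \o (fun t => weight b t * g t)).
Proof.
move=> hb mg g01; apply: (@le_integrable _ _ _ mu _ _ _ (EFin \o weight b)) => //.
- apply: measurable_EFin_comp; apply: measurable_funM => //; exact: measurable_weight.
- move=> t; rewrite /= in_itv/= => /g01 /andP[g0 g1].
  have w0 := weight_ge0 b t.
  have wg : 0 <= weight b t * g t by exact: mulr_ge0.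
  by rewrite lee_fin !ger0_norm// ler_piMr.
- exact: integrable_weight.
Qed.

(** If the integral were zero, [f] would vanish almost everywhere on [0, 1]; then the open unit
    interval, where [f] is positive, would lie in a null set, yet its measure is 1. *)
Lemma Rintegral_gt0 f : mu.-integrable `[0, 1] (EFin \o f) ->
  (forall t, 0 <= t <= 1 -> 0 <= f t) -> (forall t, 0 < t < 1 -> 0 < f t) ->
  0 < \int[mu]_(t in `[0, 1]) f t.
Proof.
move=> intf f0 fgt0; rewrite lt_neqAle Rintegral_ge0 ?andbT; last first.
  by move=> t; rewrite /= in_itv/= => /f0.
apply/negP => /eqP I0.
have mf := measurable_int _ intf.
have int0 : (\int[mu]_(t in `[0%R, 1%R]) `|(EFin \o f) t| = 0)%E.
  rewrite (_ : (\int[mu]_(t in _) _)%E = (\int[mu]_(t in `[0%R, 1%R]) (f t)%:E)%E).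
    by rewrite -(fineK (integrable_fin_num _ intf))//; congr EFin; exact/esym.
  by apply: eq_integral => t; rewrite inE/= in_itv/= => /f0 ft; rewrite ger0_norm.
have [N [mN N0 fN]] := (ae_eq_integral_abs mu (measurable_itv _) mf).1 int0.
have : (mu `]0%R, 1%R[ <= mu N)%E.
  apply: le_measure; rewrite ?inE//=.
  move=> t /=; rewrite in_itv/= => t01; apply: fN => /= ft0.
  have /ft0 [ft] : t \in `[0, 1].
    by rewrite in_itv/=; case/andP: t01 => /ltW -> /ltW ->.
  by have := fgt0 t t01; rewrite ft ltxx.
by rewrite N0 lebesgue_measure_itv/= lte_fin ltr01 oppr0 adde0 lee_fin ler10.
Qed.

(** For [b] above -1 this is the Beta value B(b + p + 1, b + q + 1). *)
Definition moment b (p q : nat) : R :=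
  \int[mu]_(t in `[0, 1]) (weight b t * (t ^+ p * (1 - t) ^+ q)).

Lemma integrable_moment b p q : -1 < b ->
  mu.-integrable `[0, 1] (EFin \o (fun t => weight b t * (t ^+ p * (1 - t) ^+ q))).
Proof.
move=> hb; apply: integrable_weightM => // [|t /andP[t0 t1]].
  apply: measurable_funM; first exact: exprn_measurable.
  apply: measurable_funX.
  exact: (@measurable_funB _ _ R setT (cst 1) id).
have s0 : 0 <= 1 - t by lra.
by rewrite mulr_ge0 ?exprn_ge0// mulr_ile1 ?exprn_ge0 ?exprn_ile1//; lra.
Qed.

Lemma moment_gt0 b p q : -1 < b -> 0 < moment b p q.
Proof.
move=> hb; apply: Rintegral_gt0; first exact: integrable_moment.
  move=> t /andP[t0 t1].
  by rewrite mulr_ge0 ?weight_ge0// mulr_ge0 ?exprn_ge0// subr_ge0.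
move=> t t01; rewrite mulr_gt0 ?weight_gt0//; case/andP: t01 => t0 t1.
by rewrite mulr_gt0 ?exprn_gt0// subr_gt0.
Qed.

Lemma momentC b p q : moment b p q = moment b q p.
Proof.
rewrite /moment /Rintegral; congr fine.
(* The absolute values change nothing on [0, 1] but make the integrand nonnegative on the whole
   line, as [ge0_integral_onem] requires. *)
pose h t := weight b t * (`|t| ^+ p * `|1 - t| ^+ q).
have mh : measurable_fun [set: R] h.
  apply: measurable_funM; first exact: measurable_weight.
  apply: measurable_funM; apply: measurable_funX.
    exact: (@measurableT_comp _ _ _ _ _ _ (@Num.norm _ R) _ id).
  apply: (@measurableT_comp _ _ _ _ _ _ (@Num.norm _ R) _ (fun t => 1 - t)) => //.
  exact: (@measurable_funB _ _ R setT (cst 1) id).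
have h0 t : 0 <= h t by rewrite mulr_ge0 ?weight_ge0// mulr_ge0 ?exprn_ge0.
transitivity (\int[mu]_(t in `[0%R, 1%R]) (h t)%:E)%E.
  apply: eq_integral => t; rewrite inE/= in_itv/= => /andP[t0 t1].
  by rewrite /h !ger0_norm// subr_ge0.
rewrite ge0_integral_onem//.
apply: eq_integral => t; rewrite inE/= in_itv/= => /andP[t0 t1].
by rewrite /h weight_onem subKr !ger0_norm ?subr_ge0// [X in _ * X]mulrC.
Qed.

(** The coefficients [x] and [z] multiply the same moment by the symmetry [momentC]. *)
Lemma Rintegral_weight_quadratic b (x y z : R) g : -1 < b ->
  (forall t, 0 <= t <= 1 ->
    g t = x * t ^+ 2 + y * (t * (1 - t)) + z * (1 - t) ^+ 2) ->
  \int[mu]_(t in `[0, 1]) (weight b t * g t) =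
  (x + z) * moment b 2 0 + y * moment b 1 1.
Proof.
move=> hb gE.
have mD : measurable (`[0, 1]%classic : set (measurableTypeR R)).
  exact: measurable_itv.
have iM p q c : mu.-integrable `[0, 1]
    (EFin \o (fun t => c * (weight b t * (t ^+ p * (1 - t) ^+ q)))).
  exact: (integrableZl mD c (integrable_moment b p q hb)).
transitivity (\int[mu]_(t in `[0, 1])
   (x * (weight b t * (t ^+ 2 * (1 - t) ^+ 0)) +
   (y * (weight b t * (t ^+ 1 * (1 - t) ^+ 1)) +
    z * (weight b t * (t ^+ 0 * (1 - t) ^+ 2))))).
  apply: eq_Rintegral => t; rewrite inE/= in_itv/= => /gE ->.
  by rewrite !expr0 !expr1; ring.
rewrite !RintegralD//; last first.
  exact: (integrableD mD (iM 1%N 1%N y) (iM 0%N 2%N z)).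
rewrite !RintegralZl ?integrable_moment//.
by rewrite -!/(moment _ _ _) (momentC b 0 2); ring.
Qed.

Lemma moment0_20 : moment 0 2 0 = 3^-1.
Proof.
rewrite momentC -[RHS](Rintegral_onemXn 2); apply: eq_Rintegral => t _.
by rewrite weight0 expr0 !mul1r.
Qed.

Lemma moment0_11 : moment 0 1 1 = 6^-1.
Proof.
have I1 : \int[mu]_(t in `[0, 1]) (weight 0 t * 1) = 1.
  under eq_Rintegral do rewrite weight0 mulr1.
  by rewrite Rintegral_cst//= lebesgue_measure_itv/= lte_fin ltr01/= mul1r subr0.
(* This is the expansion of 1 as the square of t + (1 - t), integrated term by term. *)
have : 1 = (1 + 1) * moment 0 2 0 + 2 * moment 0 1 1.
  rewrite -[LHS]I1; apply: Rintegral_weight_quadratic; first by lra.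
  by move=> t _; ring.
rewrite moment0_20; lra.
Qed.
End Weight.

(** * Functionals on a finite-dimensional function space *)

Section FunctionSpaces.
Context {R : realType} {X : Type} {n : nat} {F : set (X -> R)}
  {b : 'I_n -> X -> R} (hb : is_basis F b).

Lemma basis_linear_combination (c : 'I_n -> R) : F (fun x => \sum_i c i * b i x).
Proof. by apply/hb.1; exists c. Qed.

Lemma basis_mem i : F (b i).
Proof.
apply/hb.1; exists (fun j => (j == i)%:R) => x.
rewrite (bigD1 i)//= eqxx mul1r big1 ?addr0// => j /negbTE ->.
by rewrite mul0r.
Qed.

Lemma linear_functional_sum (L : (X -> R) -> R) (c : 'I_n -> R) :
  linear_functional_on F L ->
  L (fun x => \sum_i c i * b i x) = \sum_i c i * L (b i).
Proof.
move=> hL.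
(* Linearity of [L] is only available on [F], so the induction over the index list needs every
   partial sum to lie in [F]. The multiplicity of an index in the list gives its coefficient. *)
have Fr (r : seq 'I_n) : F (fun x => \sum_(i <- r) c i * b i x).
  apply/hb.1; exists (fun i => c i * (count_mem i r)%:R) => x.
  elim: r => [|j r IHr].
    by rewrite big_nil big1// => i _; rewrite mulr0 mul0r.
  rewrite big_cons IHr (bigD1 j)//= [in RHS](bigD1 j)//= eqxx.
  rewrite addrA natrD mulrDr mulrDl mulr1; congr (_ + _).
  by apply: eq_bigr => i ij; rewrite eq_sym (negbTE ij).
have F0 := Fr [::].
(* Linearity with scalar -1 and both functions zero gives L 0 = - L 0 + L 0. *)
have L0 : L (fun=> 0) = 0.
  have := hL (-1) _ _ F0 F0; rewrite mulN1r addNr => L0; rewrite -[RHS]L0; congr L.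
  by apply/funext => x; rewrite big_nil mulr0 addr0.
elim: (index_enum _) => [|j r IHr]; first by rewrite big_nil -[RHS]L0;
  congr L; apply/funext => x; rewrite big_nil.
rewrite big_cons -IHr -hL//; [|exact: basis_mem]; congr L.
by apply/funext => x; rewrite big_cons.
Qed.

(* The matrix (L j (b i)) is square: unisolvence says that its rows are
   independent, linear independence of the functionals that its columns are. *)
Lemma unisolvent_linearly_independent (L : 'I_n -> (X -> R) -> R) :
  (forall j, linear_functional_on F (L j)) -> unisolvent F (range L) ->
  linearly_independent_on F L.
Proof.
move=> hL uni c hc.
pose M : 'M[R]_n := \matrix_(i, j) L j (b i).
have Munit : M \in unitmx.
  rewrite -row_free_unit -kermx_eq0; apply/eqP/row_matrixP => k.
  rewrite row0; set u := row k _.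
  have : u *m M = 0 by rewrite -row_mul mulmx_ker row0.
  move: u => u uM.
  have u0 : forall x, \sum_i u 0 i * b i x = 0.
    apply: (uni (fun x => \sum_i u 0 i * b i x)).
      exact: basis_linear_combination.
    move=> _ [j _ <-]; rewrite linear_functional_sum//.
    have /rowP/(_ j) := uM; rewrite [RHS]mxE => uMj; rewrite -[RHS]uMj mxE.
    by apply: eq_bigr => i _; rewrite mxE.
  by apply/rowP => i; rewrite (hb.2 (fun i => u 0 i) u0) mxE.
have Mc : M *m (\col_j c j) = 0.
  apply/colP => i; rewrite !mxE.
  rewrite -[RHS](hc _ (basis_mem i)); apply: eq_bigr => j _.
  by rewrite !mxE mulrC.
move=> j; have : \col_j c j = 0 by rewrite -[LHS](mulKmx Munit) Mc mulmx0.
by move/colP/(_ j); rewrite !mxE.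
Qed.

End FunctionSpaces.

(** * Barycentric coordinates and quadratic forms in them *)

Section Barycentric.
Context {R : realType} (v : 'I_3 -> 'rV[R]_2) (hv : affinely_independent v).
Local Notation T := (convex_hull v).
Implicit Types (c p q l : 'I_3 -> R) (x : 'rV[R]_2).

(** Starting the sum at an arbitrary [j] lets the cyclic formulas below be computed for all [j] at
    once. *)
Lemma sum_ord3 (F : 'I_3 -> R) (j : 'I_3) :
  \sum_i F i = F j + F (ordS j) + F (ordS (ordS j)).
Proof.
rewrite !big_ord_recl big_ord0 addr0.
have oE (i k : 'I_3) : i = k :> nat -> F i = F k by move=> /val_inj ->.
case: j => -[|[|[|//]]] j3.
- by rewrite addrA; congr (_ + _ + _); apply: oE.
- by rewrite addrC; congr (_ + _ + _); apply: oE.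
- by rewrite addrA addrC addrA; congr (_ + _ + _); apply: oE.
Qed.

(** The rows are the homogeneous coordinates of the vertices. *)
Definition vertex_mx : 'M[R]_3 :=
  row_mx (\matrix_i v i : 'M[R]_(3, 2)) (const_mx 1 : 'M[R]_(3, 1)).

(** The row u solving u M = (x, 1), with M the vertex matrix, encodes both that the combination of
    vertices is [x] and that the weights sum to 1. It makes sense on the whole plane. *)
Definition bary x (i : 'I_3) : R :=
  ((row_mx x 1 : 'rV[R]_3) *m invmx vertex_mx) 0 i.

Lemma mul_vertex_mx (u : 'rV[R]_3) :
  u *m vertex_mx = row_mx (\sum_i u 0 i *: v i) (\sum_i u 0 i)%:M.
Proof.
have -> : (\sum_i u 0 i)%:M = u *m (const_mx 1 : 'M[R]_(3, 1)).
  apply/rowP => i; rewrite !mxE ord1 eqxx mulr1n.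
  by apply: eq_bigr => k _; rewrite mxE mulr1.
have -> : \sum_i u 0 i *: v i = u *m (\matrix_i v i : 'M[R]_(3, 2)).
  by rewrite mulmx_sum_row; apply: eq_bigr => i _; rewrite rowK.
exact: (@mul_mx_row _ 1 3 2 1).
Qed.

(** The two blocks of the equation for a left kernel vector are exactly the two premises of affine
    independence. *)
Lemma vertex_mx_unit : vertex_mx \in unitmx.
Proof.
rewrite -row_free_unit -kermx_eq0; apply/eqP/row_matrixP => k.
rewrite row0; set u := row k _.
have : u *m vertex_mx = 0 by rewrite -row_mul mulmx_ker row0.
move: u => u; rewrite mul_vertex_mx -[RHS](row_mx0 _ 1 2 1).
move=> /(@eq_row_mx _ 1 2 1)[u0 u1].
have /= c0 := hv (fun i => u 0 i).
apply/rowP => i; rewrite mxE c0//.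
by move/rowP: u1 => /(_ ord0); rewrite !mxE eqxx mulr1n.
Qed.

Lemma bary_combination c : \sum_i c i = 1 ->
  bary (\sum_i c i *: v i) = c.
Proof.
move=> c1; apply/funext => i; rewrite /bary.
pose u : 'rV[R]_3 := \row_i c i; have uE k : u 0 k = c k by rewrite mxE.
have -> : row_mx (\sum_i c i *: v i) 1 = u *m vertex_mx.
  rewrite mul_vertex_mx (eq_bigr c)// c1.
  by apply: (f_equal (row_mx ^~ 1)); apply: eq_bigr => k _; rewrite uE.
by rewrite mulmxK ?vertex_mx_unit// uE.
Qed.

Lemma sum_bary x : T x -> \sum_i bary x i = 1.
Proof. by move=> [c [_ c1 ->]]; rewrite bary_combination. Qed.

Lemma coordE x k : T x -> x 0 k = \sum_i v i 0 k * bary x i.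
Proof.
move=> [c [_ c1 ->]]; rewrite bary_combination// summxE.
by apply: eq_bigr => i _; rewrite mxE mulrC.
Qed.

Lemma bary_affine x i : bary x i =
  \sum_(j < 2) x 0 j * invmx vertex_mx (lshift 1 j) i +
  invmx vertex_mx (rshift 2 ord0) i.
Proof.
rewrite /bary mxE (@big_split_ord _ _ _ 2 1)/= big_ord1 (@row_mxEr _ 1 2 1 x 1) mxE eqxx mul1r.
by congr (_ + _); apply: eq_bigr => j _; rewrite (@row_mxEl _ 1 2 1 x 1).
Qed.

(** The coefficient [q j] belongs to the edge opposite vertex [j], the one over which [I_CR v j]
    integrates. *)
Definition quad p q l : R :=
  \sum_j (p j * l j ^+ 2 + q j * (l (ordS j) * l (ordS (ordS j)))).

Lemma quad_mul c d l :
  (\sum_i c i * l i) * (\sum_i d i * l i) =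
  quad (fun j => c j * d j)
    (fun j => c (ordS j) * d (ordS (ordS j)) + c (ordS (ordS j)) * d (ordS j)) l.
Proof.
have S3 (j : 'I_3) : ordS (ordS (ordS j)) = j.
  by apply: val_inj; case: j => -[|[|[|]]].
by rewrite /quad !(sum_ord3 _ ord0) !S3; ring.
Qed.
End Barycentric.

(** * Polynomial functions of bounded degree on the plane *)

Section Polynomials.
Context {R : realType}.
Implicit Types (k : nat) (f g : 'rV[R]_2 -> R).

Definition polynomial_fun k f : Prop :=
  exists2 P : mpoly.mpoly 2 R, (mpoly.msize P <= k.+1)%N
    & forall x, f x = mpoly.meval (fun i => x 0 i) P.

Lemma polynomial_fun_cst k a : polynomial_fun k (cst a).
Proof.
exists (mpoly.mpolyC 2 a) => [|x]; last by rewrite mpoly.mevalC.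
by rewrite mpoly.msizeC; case: (a != 0).
Qed.

Lemma polynomial_fun_coord k (i : 'I_2) : polynomial_fun k.+1 (fun x => x 0 i).
Proof.
exists (mpoly.mpolyX R (mpoly.mnm1 i)) => [|x]; last by rewrite mpoly.mevalXU.
by rewrite mpoly.msizeX mpoly.mdeg1.
Qed.

Lemma polynomial_funD k f g : polynomial_fun k f -> polynomial_fun k g ->
  polynomial_fun k (fun x => f x + g x).
Proof.
move=> [P Pk fP] [Q Qk gQ]; exists (P + Q) => [|x].
  by rewrite (leq_trans (mpoly.msizeD_le _ _))// geq_max Pk.
by rewrite mpoly.mevalD fP gQ.
Qed.

Lemma polynomial_funM k l f g : polynomial_fun k f -> polynomial_fun l g ->
  polynomial_fun (k + l) (fun x => f x * g x).
Proof.
move=> [P Pk fP] [Q Ql gQ]; exists (P * Q) => [|x]; last first.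
  by rewrite mpoly.mevalM fP gQ.
have [->|P0] := eqVneq P 0; first by rewrite mul0r mpoly.mmeasure0.
have [->|Q0] := eqVneq Q 0; first by rewrite mulr0 mpoly.mmeasure0.
rewrite mpoly.msizeM// -subn1 leq_subLR add1n -addSn -addnS.
(* Sizes exceed degrees by one, so the size of a product of nonzero polynomials is one less than the
   sum of the sizes. *)
exact: leq_add.
Qed.

Lemma polynomial_fun_sum k (I : finType) (F : I -> 'rV[R]_2 -> R) :
  (forall i, polynomial_fun k (F i)) ->
  polynomial_fun k (fun x => \sum_i F i x).
Proof.
move=> FP; elim: (index_enum I) => [|i r [P Pk PE]].
  by under eq_fun do rewrite big_nil; exact: polynomial_fun_cst.
under eq_fun do rewrite big_cons.
by apply: polynomial_funD => //; exists P.
Qed.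

End Polynomials.

(** * Polynomials of degree at most 2 as quadratic forms *)

Section QuadraticForms.
Context {R : realType} (v : 'I_3 -> 'rV[R]_2) (hv : affinely_independent v).
Local Notation T := (convex_hull v).
Local Notation lam := (bary v).
Implicit Types (c p q l : 'I_3 -> R) (f g : T -> R).

Definition quadratic_on f : Prop :=
  exists p q, forall x : T, f x = quad p q (lam (set_val x)).

Lemma quadZD a p q p' q' l : a * quad p q l + quad p' q' l =
  quad (fun j => a * p j + p' j) (fun j => a * q j + q' j) l.
Proof.
rewrite /quad mulr_sumr -big_split/=; apply: eq_bigr => j _; ring.
Qed.

Lemma quadratic_onZD a f g : quadratic_on f -> quadratic_on g ->
  quadratic_on (fun x => a * f x + g x).
Proof.
move=> [p [q fE]] [p' [q' gE]].
exists (fun j => a * p j + p' j), (fun j => a * q j + q' j) => x.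
by rewrite fE gE quadZD.
Qed.

Lemma quadratic_on_mul f g c d :
  (forall x : T, f x = \sum_i c i * lam (set_val x) i) ->
  (forall x : T, g x = \sum_i d i * lam (set_val x) i) ->
  quadratic_on (fun x => f x * g x).
Proof.
move=> fE gE; do 2!eexists; move=> x; rewrite fE gE; exact: quad_mul.
Qed.

(** Homogenization: on the triangle the constant 1 and both coordinates are linear forms in the
    barycentric coordinates, so each such monomial is a product of exactly two linear forms. *)
Lemma quadratic_on_monomial (a b : nat) : (a + b <= 2)%N ->
  quadratic_on (fun x => set_val x 0 ord0 ^+ a * set_val x 0 ord_max ^+ b).
Proof.
have one (x : T) : 1 = \sum_i 1 * lam (set_val x) i.
  rewrite -[LHS](sum_bary v hv _ (set_valP x)); apply: eq_bigr => i _.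
  by rewrite mul1r.
have crd k (x : T) : set_val x 0 k = \sum_i v i 0 k * lam (set_val x) i.
  exact: (coordE v hv _ _ (set_valP x)).
case: a b => [|[|[|a]]] [|[|[|b]]]//= _.
- exact: (quadratic_on_mul _ _ _ _ one one).
- exact: (quadratic_on_mul _ _ _ _ one (crd _)).
- under eq_fun do rewrite mul1r expr2.
  exact: (quadratic_on_mul _ _ _ _ (crd _) (crd _)).
- exact: (quadratic_on_mul _ _ _ _ (crd _) one).
- exact: (quadratic_on_mul _ _ _ _ (crd _) (crd _)).
- under eq_fun do rewrite mulr1 expr2.
  exact: (quadratic_on_mul _ _ _ _ (crd _) (crd _)).
Qed.

Lemma polynomials_onE f : polynomials_on 2 T f <-> quadratic_on f.
Proof.
have o1 : lift ord0 ord0 = ord_max :> 'I_2 by exact: val_inj.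
split=> [[P P3 fP]|[p [q fE]]].
  have -> : f = fun x => \sum_(m <- mpoly.msupp P) mpoly.mcoeff m P *
      (set_val x 0 ord0 ^+ m ord0 * set_val x 0 ord_max ^+ m ord_max).
    apply/funext => x; rewrite fP mpoly.mevalE; apply: eq_bigr => m _.
    by rewrite big_ord_recl big_ord1 o1.
  (* The induction runs over a list of monomials contained in the support, because only support
     monomials satisfy the degree bound. *)
  have : {subset mpoly.msupp P <= mpoly.msupp P} by [].
  elim: {1 3}(mpoly.msupp P) => [|m s IHs] sP.
    exists (fun=> 0), (fun=> 0) => x; rewrite big_nil /quad big1// => j _.
    by rewrite !mul0r addr0.
  under eq_fun do rewrite big_cons; apply: quadratic_onZD.
    apply: quadratic_on_monomial.
    have := mpoly.msize_mdeg_lt (sP _ (mem_head _ _)).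
    move=> /leq_trans/(_ P3); rewrite ltnS mpoly.mdegE big_ord_recl big_ord1.
    by rewrite o1.
  by apply: IHs => m' m's; apply: sP; rewrite inE m's orbT.
have [P P3 PE] : polynomial_fun 2 (fun x => quad p q (lam x)).
  have lamP i : polynomial_fun 1 (fun x => lam x i).
    under eq_fun do rewrite bary_affine.
    apply: polynomial_funD; last exact: polynomial_fun_cst.
    apply: polynomial_fun_sum => j.
    by apply: (@polynomial_funM _ 1 0); [exact: polynomial_fun_coord|exact: polynomial_fun_cst].
  apply: polynomial_fun_sum => j; apply: polynomial_funD.
    apply: (@polynomial_funM _ 0 2); first exact: polynomial_fun_cst.
    exact: (@polynomial_funM _ 1 1).
  apply: (@polynomial_funM _ 0 2); first exact: polynomial_fun_cst.
  exact: (@polynomial_funM _ 1 1).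
by exists P => // x; rewrite fE PE.
Qed.

End QuadraticForms.

(** * The functionals on quadratic forms, and unisolvence *)

Section Functionals.
Context {R : realType} (v : 'I_3 -> 'rV[R]_2) (hv : affinely_independent v).
Local Notation T := (convex_hull v).
Local Notation lam := (bary v).
Implicit Types (c d p q l : 'I_3 -> R) (f g : T -> R) (b t : R) (j : 'I_3).

(** Polarization: the coefficient of t (1 - t) is the polar form of the quadratic form at [c] and
    [d]. *)
Lemma quad_segment p q c d t : quad p q (fun i => t * c i + (1 - t) * d i) =
  quad p q c * t ^+ 2 +
  (quad p q (fun i => c i + d i) - quad p q c - quad p q d) * (t * (1 - t)) +
  quad p q d * (1 - t) ^+ 2.
Proof. by rewrite /quad !(sum_ord3 _ ord0); ring. Qed.

Lemma segment_integral_quad b p q c d f : -1 < b ->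
  (forall i, 0 <= c i) -> (forall i, 0 <= d i) ->
  \sum_i c i = 1 -> \sum_i d i = 1 ->
  (forall x : T, f x = quad p q (lam (set_val x))) ->
  segment_integral (weight b) (\sum_i c i *: v i) (\sum_i d i *: v i) f =
  (quad p q c + quad p q d) * moment b 2 0 +
  (quad p q (fun i => c i + d i) - quad p q c - quad p q d) * moment b 1 1.
Proof.
move=> hb c0 d0 c1 d1 fE; apply: Rintegral_weight_quadratic => // t /andP[t0 t1].
pose e i := t * c i + (1 - t) * d i.
have e1 : \sum_i e i = 1.
  by rewrite big_split/= -!mulr_sumr c1 d1; ring.
have -> : t *: (\sum_i c i *: v i) + (1 - t) *: (\sum_i d i *: v i) =
    \sum_i e i *: v i.
  rewrite !scaler_sumr -big_split; apply: eq_bigr => i _ /=.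
  by rewrite [RHS]scalerDl !scalerA.
have Te : T (\sum_i e i *: v i).
  by exists e; split=> // i; rewrite addr_ge0 ?mulr_ge0 ?subr_ge0.
(* Once [f] is a restriction to the triangle, its extension by zero agrees with the form at the
   segment point, which lies in the triangle by [Te]. *)
have -> : f = sigL T (quad p q \o lam) by apply/funext => x; rewrite fE.
rewrite -[LHS]/((valL_ 0 \o sigL T) (quad p q \o lam) (\sum_i e i *: v i)) sigLK.
by rewrite patchE mem_set//= bary_combination// quad_segment.
Qed.

Lemma vertexE j : v j = \sum_i (i == j)%:R *: v i.
Proof.
rewrite (bigD1 j)//= eqxx scale1r big1 ?addr0// => i /negbTE ->.
by rewrite scale0r.
Qed.

Lemma sum_delta j : \sum_i (i == j)%:R = 1 :> R.
Proof. by rewrite (bigD1 j)//= eqxx big1 ?addr0// => i /negbTE ->. Qed.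

Lemma barycenterE : barycenter v = \sum_i (3^-1 : R) *: v i.
Proof. by rewrite /barycenter scaler_sumr. Qed.

Lemma ordS3E j : [/\ ordS (ordS (ordS j)) = j, (ordS j == j) = false,
  (ordS (ordS j) == j) = false, (ordS (ordS j) == ordS j) = false &
  ((j == ordS j) = false) * ((j == ordS (ordS j)) = false) *
  ((ordS j == ordS (ordS j)) = false)].
Proof. by case: j => -[|[|[|//]]] j3; do !split; apply: val_inj. Qed.

Lemma I_CR_quad p q j f : (forall x : T, f x = quad p q (lam (set_val x))) ->
  I_CR v j f = (p (ordS j) + p (ordS (ordS j))) / 3 + q j / 6.
Proof.
(* The constant weight is the case of exponent 0, so edges and medians share one formula. *)
move=> fE; have -> : I_CR v j f =
    segment_integral (weight 0) (v (ordS j)) (v (ordS (ordS j))) f.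
  by congr segment_integral; apply/funext => t; rewrite weight0.
rewrite (vertexE (ordS j)) (vertexE (ordS (ordS j))).
rewrite (@segment_integral_quad _ p q)// ?sum_delta//.
have [S3 e1 e2 e3 [[e4 e5] e6]] := ordS3E j.
rewrite moment0_20 moment0_11 /quad !(sum_ord3 _ j) !S3 !eqxx e3 e4 e5 e6 /=.
by field.
Qed.

Lemma G_enr_quad b p q j f : -1 < b ->
  (forall x : T, f x = quad p q (lam (set_val x))) ->
  G_enr v b j f =
  (p j + \sum_i (p i + q i) / 9) * moment b 2 0 +
  (2 / 3 * p j + (q (ordS j) + q (ordS (ordS j))) / 3) * moment b 1 1.
Proof.
move=> hb fE; rewrite /G_enr (vertexE j) barycenterE.
rewrite (@segment_integral_quad _ p q)//; [|exact: sum_delta|]; last first.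
  by rewrite (sum_ord3 _ ord0); field.
have [S3 e1 e2 e3 [[e4 e5] e6]] := ordS3E j.
rewrite /quad !(sum_ord3 _ j) !S3 !eqxx e1 e2 /=.
by field.
Qed.

(** The conclusion concerns the coefficients rather than [f], so that it yields both unisolvence and
    the independence of the basis. *)
Lemma quad_unisolvent b p q f : -1 < b ->
  (forall x : T, f x = quad p q (lam (set_val x))) ->
  (forall j, I_CR v j f = 0) -> (forall j, G_enr v b j f = 0) ->
  (forall j, p j = 0) /\ (forall j, q j = 0).
Proof.
move=> hb fE hI hG.
have D0 := moment_gt0 b 2 0 hb; have E0 := moment_gt0 b 1 1 hb.
have qE j : q j = - 2 * (p (ordS j) + p (ordS (ordS j))).
  by have := hI j; rewrite (I_CR_quad p q j f fE); lra.
pose P := \sum_i p i.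
have PE j : P = p j + p (ordS j) + p (ordS (ordS j)) by exact: sum_ord3.
(* By [qE] the sum of all [q] is - 4 P, and the two [q] other than [q j] sum to - 2 (P + p_j). *)
have GE j : (p j - P / 3) * moment b 2 0 = 2 / 3 * P * moment b 1 1.
  have := hG j; rewrite (G_enr_quad b p q j f hb fE) (sum_ord3 _ j) !qE.
  have [-> _ _ _ _] := ordS3E j; rewrite (PE j) => GE.
  by apply/eqP; rewrite -subr_eq0 -[X in _ == X]GE; apply/eqP; field.
have P0 : P = 0.
  (* Adding the three equations cancels the left-hand sides and leaves 2 P E = 0. *)
  have /eqP : P * moment b 1 1 = 0.
    have := GE ord0; have := GE (ordS ord0); have := GE (ordS (ordS ord0)).
    by rewrite (PE ord0); lra.
  by rewrite mulf_eq0 (gt_eqF E0) orbF => /eqP.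
have p0 j : p j = 0.
  have /eqP := GE j; rewrite P0 mul0r subr0 mulr0 mul0r mulf_eq0 (gt_eqF D0) orbF.
  by move/eqP.
by split=> // j; rewrite qE !p0; ring.
Qed.
End Functionals.

(** * Concatenation of two finite families *)

Section SplitIndex.
Context {A : Type} {m n : nat} (F : 'I_m -> A) (G : 'I_n -> A).

Definition cat_fun (i : 'I_(m + n)) : A :=
  match fintype.split i with inl j => F j | inr j => G j end.

Lemma cat_fun_lshift j : cat_fun (lshift n j) = F j.
Proof. by rewrite /cat_fun (unsplitK (inl _ j)). Qed.

Lemma cat_fun_rshift j : cat_fun (rshift m j) = G j.
Proof. by rewrite /cat_fun (unsplitK (inr _ j)). Qed.

Lemma range_cat_fun : range cat_fun = range F `|` range G.
Proof.
apply/seteqP; split=> [_ [i _ <-]|_ [[j _ <-]|[j _ <-]]].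
- by case: (split_ordP i) => j ->;
    rewrite ?cat_fun_lshift ?cat_fun_rshift; [left|right]; exists j.
- by exists (lshift n j); rewrite ?cat_fun_lshift.
- by exists (rshift m j); rewrite ?cat_fun_rshift.
Qed.

End SplitIndex.

(** * Basis, functionals and assembly of the finite element *)

Section Element.
Context {R : realType} (v : 'I_3 -> 'rV[R]_2) (hv : affinely_independent v).
Context (beta : R) (hbeta : -1 < beta).
Local Notation T := (convex_hull v).

Definition quad_basis : 'I_(3 + 3) -> T -> R :=
  cat_fun (fun j x => bary v (set_val x) j ^+ 2)
    (fun j x => bary v (set_val x) (ordS j) * bary v (set_val x) (ordS (ordS j))).

Lemma sum_quad_basis (c : 'I_(3 + 3) -> R) (x : T) : \sum_i c i * quad_basis i x =
  quad (fun j => c (lshift 3 j)) (fun j => c (rshift 3 j)) (bary v (set_val x)).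
Proof.
rewrite big_split_ord /quad big_split/=; congr (_ + _); apply: eq_bigr => j _.
  by rewrite /quad_basis cat_fun_lshift.
by rewrite /quad_basis cat_fun_rshift.
Qed.

Lemma quad_basisP : is_basis (polynomials_on 2 T) quad_basis.
Proof.
split=> [f|c c0].
  split=> [/(polynomials_onE _ hv)[p [q fE]]|[c fE]].
    exists (cat_fun p q) => x; rewrite fE sum_quad_basis.
    by congr quad; apply/funext => j; rewrite ?cat_fun_lshift ?cat_fun_rshift.
  apply/(polynomials_onE _ hv); do 2!eexists; move=> x; rewrite fE.
  exact: sum_quad_basis.
(* All functionals vanish on the zero function, so any coefficients representing it are zero by
   [quad_unisolvent]. *)
pose z : T -> R := fun=> 0.
have zE (x : T) : z x = quad (fun=> 0) (fun=> 0) (bary v (set_val x)).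
  by rewrite /quad big1// => j _; rewrite !mul0r addr0.
have [p0 q0] : (forall j, c (lshift 3 j) = 0) /\ (forall j, c (rshift 3 j) = 0).
  apply: (quad_unisolvent v hv beta _ _ z) => // [x|j|j].
  - by rewrite -sum_quad_basis c0.
  - by rewrite (I_CR_quad v hv _ _ _ _ zE)/=; lra.
  - by rewrite (G_enr_quad v hv _ _ _ _ _ hbeta zE) /= (sum_ord3 _ j); ring.
by move=> i; case: (split_ordP i) => j ->; [exact: p0|exact: q0].
Qed.

Definition functionals : 'I_(3 + 3) -> (T -> R) -> R :=
  cat_fun (I_CR v) (G_enr v beta).

(** The closed formulas of the functionals are linear in the coefficients [p] and [q]. *)
Lemma functionals_linear i : linear_functional_on (polynomials_on 2 T) (functionals i).
Proof.
move=> a f g /(polynomials_onE _ hv)[p [q fE]] /(polynomials_onE _ hv)[p' [q' gE]].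
have hE (x : T) : a * f x + g x = quad (fun j => a * p j + p' j)
    (fun j => a * q j + q' j) (bary v (set_val x)).
  by rewrite fE gE quadZD.
case: (split_ordP i) => j -> {i}; rewrite /functionals.
  rewrite !cat_fun_lshift (I_CR_quad v hv _ _ _ _ hE).
  by rewrite (I_CR_quad v hv _ _ _ _ fE) (I_CR_quad v hv _ _ _ _ gE); field.
rewrite !cat_fun_rshift (G_enr_quad v hv _ _ _ _ _ hbeta hE).
rewrite (G_enr_quad v hv _ _ _ _ _ hbeta fE) (G_enr_quad v hv _ _ _ _ _ hbeta gE).
by rewrite !(sum_ord3 _ ord0); field.
Qed.

Lemma functionals_unisolvent : unisolvent (polynomials_on 2 T) (range functionals).
Proof.
move=> f /(polynomials_onE _ hv)[p [q fE]] f0 x.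
have [p0 q0] : (forall j, p j = 0) /\ (forall j, q j = 0).
  apply: (quad_unisolvent v hv beta p q f) => // j.
    by apply: f0; exists (lshift 3 j); rewrite // /functionals cat_fun_lshift.
  by apply: f0; exists (rshift 3 j); rewrite // /functionals cat_fun_rshift.
by rewrite fE /quad big1// => j _; rewrite p0 q0 !mul0r addr0.
Qed.

End Element.

Theorem theorem3p4 (R : realType) (v : 'I_3 -> 'rV[R]_2)
    (hv : affinely_independent v) (beta : R) (hbeta : -1 < beta) :
  let T := convex_hull v in
  is_finite_element T (polynomials_on 2 T) (Sigma_enr v beta).
Proof.
move=> T; have uni := functionals_unisolvent v hv beta hbeta.
have lin := functionals_linear v hv beta hbeta.
have SE : Sigma_enr v beta = range (functionals v beta) by rewrite range_cat_fun.
(* The witness 2 means three vertices, since [is_polytope] counts from one point. *)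
split; first by exists 2%N, v.
exists (3 + 3)%N; rewrite SE; split; [|split=> //].
  by exists (quad_basis v); exact: (quad_basisP v hv beta hbeta).
exists (functionals v beta); split=> //.
exact: (unisolvent_linearly_independent (quad_basisP v hv beta hbeta)).
Qed.
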